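(* Let $G$ and $H$ be groups. Then there exists a one-to-one correspondence between isomorphism classes of topologically free continuous orbit couples for $G$ and $H$ and isomorphism classes of topologically free topological couplings for $G$ and $H$.
   Context: All groups are discrete and countable; all topological spaces are locally compact and Hausdorff. A topological dynamical system $G \curvearrowright X$ is an action $(g,x) \mapsto g.x$ by homeomorphisms; it is topologically free if for every $e \neq g \in G$ the set $\{x \in X : g.x \neq x\}$ is dense in $X$. Topological couplings: a topological coupling for $G$ and $H$ consists of a locally compact Hausdorff space $\Omega$ with commuting free and proper left $G$- and right $H$-actions which admit compact open fundamental domains $\bar{X}$ (for the $H$-action) and $\bar{Y}$ (for the $G$-action); the fundamental domains are part of the data. Here a compact open fundamental domain $\bar{X}$ for $\Omega \curvearrowleft H$ is a compact open subset $\bar{X} \subseteq \Omega$ such that $\bar{X} \times H \to \Omega$, $(x,h) \mapsto xh$ is a homeomorphism ($H$ discrete), and analogously for $G$. The coupling is topologically free if the corresponding action $G \times H \curvearrowright \Omega$ is topologically free. Two couplings $(\Omega_1,\bar{X}_1,\bar{Y}_1)$ and $(\Omega_2,\bar{X}_2,\bar{Y}_2)$ are isomorphic if there is a $G \times H$-equivariant homeomorphism $\Omega_1 \to \Omega_2$ sending $\bar{X}_1$ to $\bar{X}_2$ and $\bar{Y}_1$ to $\bar{Y}_2$. Continuous orbit couples: a continuous orbit couple for $G$ and $H$ consists of topological dynamical systems $G \curvearrowright X$, $H \curvearrowright Y$ on compact spaces $X$, $Y$ and continuous maps $p: X \to Y$, $q: Y \to X$ for which there exist continuous maps $a: G \times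 X \to H$, $b: H \times Y \to G$, $g: X \to G$, $h: Y \to H$ such that $p(s.x) = a(s,x).p(x)$, $q(t.y) = b(t,y).q(y)$, $qp(x) = g(x).x$ and $pq(y) = h(y).y$ for all $s \in G$, $t \in H$, $x \in X$, $y \in Y$. It is topologically free if $G \curvearrowright X$ and $H \curvearrowright Y$ are topologically free. Continuous orbit couples $(p_i,q_i)$ for $G \curvearrowright X_i$, $H \curvearrowright Y_i$ ($i=1,2$) are isomorphic if there are a $G$-equivariant homeomorphism $\theta: X_1 \to X_2$ and an $H$-equivariant homeomorphism $\eta: Y_1 \to Y_2$ with $\eta \circ p_1 = p_2 \circ \theta$ and $\theta \circ q_1 = q_2 \circ \eta$. *)

(* Defs.v *)
From HB Require Import structures.
From mathcomp Require Import all_boot all_classical all_reals all_analysis.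

Set Implicit Arguments.
Unset Strict Implicit.
Unset Printing Implicit Defensive.

Local Open Scope classical_set_scope.
Local Open Scope group_scope.

(* A groupType carries no topology: discrete_topology G is the same type,
   viewed as a discrete topological space. *)

Definition homeomorphism (X Y : topologicalType) (f : X -> Y) : Prop :=
  continuous f /\
  exists f' : Y -> X, [/\ continuous f', cancel f f' & cancel f' f].

Definition proper_map (X Y : topologicalType) (f : X -> Y) : Prop :=
  continuous f /\ forall K : set Y, compact K -> compact (f @^-1` K).

Definition left_action (G : groupType) (X : Type) (act : G -> X -> X) : Prop :=
  (forall x, act 1 x = x) /\ (forall s t x, act (s * t) x = act s (act t x)).

Definition right_action (H : groupType) (X : Type) (ract : X -> H -> X) : Prop :=
  (forall x, ract x 1 = x) /\
  (forall x s t, ract x (s * t) = ract (ract x s) t).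

(* The next four notions do not depend on the side on which the group acts;
   they are used for a right action ract through fun h x => ract x h. *)
Definition by_homeomorphisms (G : Type) (X : topologicalType)
    (act : G -> X -> X) : Prop :=
  forall s, homeomorphism (act s).

Definition free_action (G : groupType) (X : Type) (act : G -> X -> X) : Prop :=
  forall s x, act s x = x -> s = 1.

Definition proper_action (G : groupType) (X : topologicalType)
    (act : G -> X -> X) : Prop :=
  proper_map (fun sx : discrete_topology G * X => (act sx.1 sx.2, sx.2)).

Definition compact_open_fundamental_domain (G : groupType)
    (X : topologicalType) (act : G -> X -> X) (D : set X) : Prop :=
  [/\ compact D, open D &
      homeomorphism
        (fun xs : set_type D * discrete_topology G => act xs.2 (set_val xs.1))].

(* The identity e is a parameter so that the same definition serves G and
   the direct product G * H. *)
Definition topologically_free_action (G : Type) (e : G) (X : topologicalType)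
    (act : G -> X -> X) : Prop :=
  forall s, s <> e -> dense [set x | act s x <> x].

Section OrbitCouplesAndCouplings.
Variables G H : groupType.

Record topological_coupling := TopologicalCoupling {
  tc_space : topologicalType;
  tc_lact : G -> tc_space -> tc_space;
  tc_ract : tc_space -> H -> tc_space;
  tc_X : set tc_space;
  tc_Y : set tc_space;
  tc_hausdorff : hausdorff_space tc_space;
  tc_locally_compact : locally_compact [set: tc_space];
  tc_lactP : left_action tc_lact;
  tc_ractP : right_action tc_ract;
  tc_lact_homeo : by_homeomorphisms tc_lact;
  tc_ract_homeo : by_homeomorphisms (fun h w => tc_ract w h);
  tc_commute : forall s t w, tc_ract (tc_lact s w) t = tc_lact s (tc_ract w t);
  tc_lact_free : free_action tc_lact;
  tc_ract_free : free_action (fun h w => tc_ract w h);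
  tc_lact_proper : proper_action tc_lact;
  tc_ract_proper : proper_action (fun h w => tc_ract w h);
  tc_X_domain : compact_open_fundamental_domain (fun h w => tc_ract w h) tc_X;
  tc_Y_domain : compact_open_fundamental_domain tc_lact tc_Y
}.

Definition tc_act (W : topological_coupling) (st : G * H) (w : tc_space W) :
    tc_space W :=
  tc_lact st.1 (tc_ract w st.2^-1).

Definition tc_topologically_free (W : topological_coupling) : Prop :=
  topologically_free_action (1, 1) (@tc_act W).

Definition tc_isomorphic (W1 W2 : topological_coupling) : Prop :=
  exists phi : tc_space W1 -> tc_space W2,
    [/\ homeomorphism phi,
        forall st w, phi (tc_act st w) = tc_act st (phi w),
        phi @` @tc_X W1 = @tc_X W2 &
        phi @` @tc_Y W1 = @tc_Y W2].

Record continuous_orbit_couple := ContinuousOrbitCouple {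
  oc_X : topologicalType;
  oc_Y : topologicalType;
  oc_actX : G -> oc_X -> oc_X;
  oc_actY : H -> oc_Y -> oc_Y;
  oc_p : oc_X -> oc_Y;
  oc_q : oc_Y -> oc_X;
  oc_hausdorffX : hausdorff_space oc_X;
  oc_hausdorffY : hausdorff_space oc_Y;
  oc_compactX : compact [set: oc_X];
  oc_compactY : compact [set: oc_Y];
  oc_actXP : left_action oc_actX;
  oc_actYP : left_action oc_actY;
  oc_actX_homeo : by_homeomorphisms oc_actX;
  oc_actY_homeo : by_homeomorphisms oc_actY;
  oc_p_continuous : continuous oc_p;
  oc_q_continuous : continuous oc_q;
  oc_cocycles :
    exists (a : discrete_topology G * oc_X -> discrete_topology H)
           (b : discrete_topology H * oc_Y -> discrete_topology G)
           (g : oc_X -> discrete_topology G)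
           (h : oc_Y -> discrete_topology H),
      [/\ continuous a, continuous b, continuous g & continuous h] /\
      [/\ forall s x, oc_p (oc_actX s x) = oc_actY (a (s, x)) (oc_p x),
          forall t y, oc_q (oc_actY t y) = oc_actX (b (t, y)) (oc_q y),
          forall x, oc_q (oc_p x) = oc_actX (g x) x &
          forall y, oc_p (oc_q y) = oc_actY (h y) y]
}.

Definition oc_topologically_free (C : continuous_orbit_couple) : Prop :=
  topologically_free_action 1 (@oc_actX C) /\
  topologically_free_action 1 (@oc_actY C).

Definition oc_isomorphic (C1 C2 : continuous_orbit_couple) : Prop :=
  exists (theta : oc_X C1 -> oc_X C2) (eta : oc_Y C1 -> oc_Y C2),
    [/\ homeomorphism theta /\ homeomorphism eta,
        forall s x, theta (oc_actX s x) = oc_actX s (theta x),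
        forall t y, eta (oc_actY t y) = oc_actY t (eta y),
        eta \o @oc_p C1 = @oc_p C2 \o theta &
        theta \o @oc_q C1 = @oc_q C2 \o eta].

End OrbitCouplesAndCouplings.

(* The quotient of {c | P c} by iso, a class being its predicate of members.
   T ranges over types of spaces, too large a universe for the library's set T. *)
Definition isomorphism_class (T : Type) (P : T -> Prop)
    (iso : T -> T -> Prop) : Type :=
  {C : T -> Prop | exists c, P c /\ C = (fun d => P d /\ iso c d)}.

(* Main.v *)
(* The correspondence is the relation "W realizes C": X and Y are identified
   with the fundamental domains of W in such a way that the dynamics of C is the one
   that G and H induce on Omega/H = X and G\Omega = Y, and p and q are induced
   by the two quotient maps.  Every coupling realizes the couple on its own
   fundamental domains, and C is realized by X * H with
   s.(x,t) = (s.x, a(s,x) t), where Y sits inside as the points (q(y), h(y)).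

   Topological freeness enters through uniqueness of cocycles.  The maps p and q
   are open, so a continuous a with p(s.x) = a(s,x).p(x) is determined by
   the couple.  Hence a satisfies the cocycle identity, the formulas above
   define commuting actions with the expected fundamental domains, and
   isomorphic couples have isomorphic realizations. *)
Require Import Defs.
From mathcomp Require Import all_boot all_classical all_reals all_analysis.

Set Implicit Arguments.
Unset Strict Implicit.
Unset Printing Implicit Defensive.

Local Open Scope classical_set_scope.
Local Open Scope group_scope.

(** * Topological preliminaries *)

Lemma continuous_to_discreteP (X : topologicalType) (T : choiceType)
    (f : X -> discrete_topology T) :
  continuous f <-> forall x, \forall x' \near x, f x' = f x.
Proof.
split=> fc x; first exact: (fc x _ (discrete_set1 _)).
exact/discrete_cvg/fc.
Qed.

Lemma discrete_continuous (T : choiceType) (Z : topologicalType)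
    (f : discrete_topology T -> Z) : continuous f.
Proof.
move=> t U /nbhs_singleton Uft.
change (nbhs t (f @^-1` U)).
have /(filterS _) := discrete_set1 (t : discrete_topology T); apply.
by move=> ? ->.
Qed.

(** Near each point [k] is constant, so the map agrees there with a single [F t] composed with [u].
    This yields joint continuity for actions of discrete groups. *)
Lemma continuous_family (T : choiceType) (A X Z : topologicalType)
    (F : T -> X -> Z) (k : A -> discrete_topology T) (u : A -> X) :
  (forall t, continuous (F t)) -> continuous k -> continuous u ->
  continuous (fun a => F (k a) (u a)).
Proof.
move=> Fc /continuous_to_discreteP kc uc a U FU.
have FUu : nbhs a (u @^-1` (F (k a) @^-1` U)) by apply: uc; apply: Fc.
change (nbhs a [set a' | U (F (k a') (u a'))]).
by apply: filterS (filterI (kc a) FUu) => a' [/= ->].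
Qed.

Lemma continuous_discrete_op2 (A : topologicalType) (S T U : choiceType)
    (op : S -> T -> U) (f : A -> discrete_topology S)
    (g : A -> discrete_topology T) : continuous f -> continuous g ->
  continuous (fun a => op (f a) (g a) : discrete_topology U).
Proof.
apply: (@continuous_family _ _ (discrete_topology T)
  (discrete_topology U)) => s.
exact: discrete_continuous.
Qed.

Lemma continuous_discrete_op (A : topologicalType) (S T : choiceType)
    (op : S -> T) (f : A -> discrete_topology S) : continuous f ->
  continuous (fun a => op (f a) : discrete_topology T).
Proof.
by move=> fc; exact: (@continuous_discrete_op2 _ _ _ _ (fun=> op) f f).
Qed.

Lemma continuous_comp_fun (X Y Z : topologicalType) (f : X -> Y) (g : Y -> Z) :
  continuous f -> continuous g -> continuous (fun x => g (f x)).
Proof. by move=> fc gc x; apply: continuous_comp; [exact: fc|exact: gc]. Qed.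

Lemma continuous_pair (A X Y : topologicalType) (f : A -> X) (g : A -> Y) :
  continuous f -> continuous g -> continuous (fun a => (f a, g a)).
Proof. by move=> fc gc a; apply: cvg_pair; [exact: fc|exact: gc]. Qed.

Lemma continuous_fst (X Y : topologicalType) : continuous (@fst X Y).
Proof. by move=> xy; exact: cvg_fst. Qed.

Lemma continuous_snd (X Y : topologicalType) : continuous (@snd X Y).
Proof. by move=> xy; exact: cvg_snd. Qed.

Lemma continuous_idfun (X : topologicalType) : continuous (fun x : X => x).
Proof. by move=> x. Qed.

Lemma continuous_set_val (X : topologicalType) (D : set X) :
  continuous (set_val : D -> X).
Proof. exact: initial_continuous. Qed.

Lemma set_val_inj (X : Type) (D : set X) : injective (set_val : D -> X).
Proof. exact: val_inj. Qed.

Lemma continuous_to_set_type (A X : topologicalType) (D : set X) (f : A -> D) :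
  continuous (fun a => set_val (f a)) -> continuous f.
Proof.
move=> fc a U [_ [[V oV <-] Va VU]].
apply: (filterS (fun b Vb => VU (f b) Vb)).
by apply: fc; apply: open_nbhs_nbhs.
Qed.

Lemma hausdorff_prod (X Y : topologicalType) :
  hausdorff_space X -> hausdorff_space Y -> hausdorff_space (X * Y)%type.
Proof.
move=> hX hY [x y] [x' y'] cl; congr pair; [apply: hX|apply: hY] => A B nA nB.
  have [] := cl (fst @^-1` A) (fst @^-1` B); [exact: continuous_fst..|].
  by move=> z [? ?]; exists z.1.
have [] := cl (snd @^-1` A) (snd @^-1` B); [exact: continuous_snd..|].
by move=> z [? ?]; exists z.2.
Qed.

Lemma hausdorff_set_type (X : topologicalType) (D : set X) :
  hausdorff_space X -> hausdorff_space D.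
Proof.
move=> hX p q cl; apply: set_val_inj; apply: hX => A B nA nB.
have [] := cl (set_val @^-1` A) (set_val @^-1` B).
- exact: continuous_set_val.
- exact: continuous_set_val.
by move=> z [? ?]; exists (set_val z).
Qed.

(** A filter on the subtype is pushed forward along [set_val]; a cluster point of the image in [D]
    is a cluster point of the original filter. *)
Lemma compact_set_type (X : topologicalType) (D : set X) :
  compact D -> compact [set: D].
Proof.
move=> cD F FF _.
have FD : (set_val @ F) D.
  change (F (set_val @^-1` D)).
  by apply: (@filterS _ _ _ setT) filterT => d _; exact: set_valP.
have [p [Dp clp]] := cD (set_val @ F) _ FD.
exists (SigSub (mem_set Dp)); split=> // A B FA [_ [[V oV <-] Vp VB]].
have FA' : (set_val @ F) (set_val @` A).
  change (F (set_val @^-1` (set_val @` A))).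
  by apply: filterS FA => d Ad; exists d.
have [] := clp _ _ FA' (open_nbhs_nbhs (conj oV Vp)).
by move=> _ [[d Ad <-] Vd]; exists d; split=> //; exact: VB.
Qed.

Lemma continuous_compact_image (X Y : topologicalType) (f : X -> Y)
    (K : set X) :
  continuous f -> compact K -> compact (f @` K).
Proof. by move=> fc; apply: continuous_compact; exact: continuous_subspaceT. Qed.

Lemma compact_discrete_finite (T : choiceType)
    (K : set (discrete_topology T)) : compact K -> finite_set K.
Proof.
move=> cK; apply: contrapT => infK.
(* For infinite [K] this is a proper filter. No [t] in [K] is a cluster point: [K] without [t]
   belongs to the filter and misses the neighbourhood [{t}]. *)
pose F : set_system (discrete_topology T) := [set A | finite_set (K `\` A)].
have FF : ProperFilter F.
  split; first by rewrite /F /= setD0.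
  split; first by rewrite /F /= setDT.
    by move=> A B FA FB; rewrite /F /= setDIr finite_setU.
  by move=> A B AB FA; apply: sub_finite_set FA; exact: setDS.
have [|t [Kt clt]] := cK F FF; first by rewrite /F /= setDv.
have [|u [[_ ]]] := clt (K `\ t) _ _ (discrete_set1 t); last by [].
by apply: sub_finite_set (finite_set1 t) => u [Ku /not_andP[]// /contrapT].
Qed.

Lemma homeomorphism_id (X : topologicalType) : homeomorphism (fun x : X => x).
Proof.
split; first exact: continuous_idfun.
by exists id; split=> //; exact: continuous_idfun.
Qed.

Lemma homeomorphism_comp (X Y Z : topologicalType) (f : X -> Y) (g : Y -> Z) :
  homeomorphism f -> homeomorphism g -> homeomorphism (fun x => g (f x)).
Proof.
move=> [fc [f' [f'c fK f'K]]] [gc [g' [g'c gK g'K]]]; split.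
  exact: continuous_comp_fun.
exists (fun z => f' (g' z)); split; first exact: continuous_comp_fun.
- by move=> x; rewrite gK fK.
- by move=> z; rewrite f'K g'K.
Qed.

(* Preimages of compact sets lie in S * K_2 for a finite set S. *)
Lemma proper_of_displacement (G : groupType) (Z : topologicalType)
    (T : choiceType) (act : G -> Z -> Z) (k : Z -> discrete_topology T)
    (d : T -> T -> G) :
  hausdorff_space Z -> by_homeomorphisms act -> continuous k ->
  (forall s z, d (k (act s z)) (k z) = s) -> proper_action act.
Proof.
move=> hZ hact kc dE.
have Fc : continuous
    (fun sx : discrete_topology G * Z => (act sx.1 sx.2, sx.2)).
  apply: continuous_pair; last exact: continuous_snd.
  apply: (@continuous_family _ _ _ _ act fst snd).
  - by move=> s; case: (hact s).
  - exact: continuous_fst.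
  - exact: continuous_snd.
split=> // K cK.
have fin1 : finite_set ((fun z => k z.1) @` K).
  apply: compact_discrete_finite; apply: continuous_compact_image => //.
  by apply: continuous_comp_fun kc; exact: continuous_fst.
have fin2 : finite_set ((fun z => k z.2) @` K).
  apply: compact_discrete_finite; apply: continuous_compact_image => //.
  by apply: continuous_comp_fun kc; exact: continuous_snd.
pose S : set (discrete_topology G) :=
  [set d a b | a in (fun z => k z.1) @` K & b in (fun z => k z.2) @` K].
have cS : compact S by apply: finite_compact; exact: finite_image2.
have cSK : compact (S `*` (snd @` K)).
  by apply: compact_setX => //; apply: continuous_compact_image => //;
    exact: continuous_snd.
apply: (subclosed_compact _ cSK).
  apply: preimage_closed => [z _|]; first exact: Fc.
  by apply: compact_closed => //; exact: hausdorff_prod.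
move=> [s z] /= Ksz; split; last by exists (act s z, z).
exists (k (act s z)); first by exists (act s z, z).
by exists (k z); [exists (act s z, z)|exact: dE].
Qed.

(** The slice over [t] is a compact closed neighbourhood of each of its points. *)
Lemma locally_compact_prod_discrete (X : topologicalType) (T : choiceType) :
  hausdorff_space X -> compact [set: X] ->
  locally_compact [set: X * discrete_topology T].
Proof.
move=> hX cX [x t] _; exists (snd @^-1` [set t]).
  have nt : nbhs (x, t) (snd @^-1` [set t]).
    have := @continuous_snd X (discrete_topology T) (x, t) [set t]; apply.
    exact: discrete_set1.
  exact: (filterS (fun z zt _ => zt) nt).
split.
  rewrite (_ : _ @^-1` _ = [set: X] `*` [set t]).
    by apply: compact_setX => //; exact: compact_set1.
  by apply/seteqP; split=> [[x' t']|[x' t'] []].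
apply: preimage_closed; last exact: discrete_closed.
by move=> z _; exact: continuous_snd.
Qed.

(** * Fundamental domains *)

Lemma left_actK (G : groupType) (X : Type) (act : G -> X -> X) s :
  left_action act -> cancel (act s) (act s^-1).
Proof. by move=> [act1 actM] x; rewrite -actM mulVg act1. Qed.

Lemma left_actVK (G : groupType) (X : Type) (act : G -> X -> X) s :
  left_action act -> cancel (act s^-1) (act s).
Proof. by move=> [act1 actM] x; rewrite -actM mulgV act1. Qed.

Lemma left_action_by_homeomorphisms (G : groupType) (X : topologicalType)
    (act : G -> X -> X) :
  left_action act -> (forall s, continuous (act s)) -> by_homeomorphisms act.
Proof.
move=> actP actc s; split; first exact: actc.
by exists (act s^-1); split; [exact: actc|exact: left_actK|exact: left_actVK].
Qed.

Lemma fundamental_domain_compact (G : groupType) (X : topologicalType)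
    (act : G -> X -> X) (D : set X) :
  compact_open_fundamental_domain act D -> compact D.
Proof. by case. Qed.

Section FundamentalDomain.
Variables (G : groupType) (X : topologicalType) (act : G -> X -> X) (D : set X).

Section Coordinates.
Hypothesis hD : compact_open_fundamental_domain act D.

Let inverse_exists : exists f : X -> D * discrete_topology G,
  [/\ continuous f, forall (d : D) g, f (act g (set_val d)) = (d, g) &
      forall x, act (f x).2 (set_val (f x).1) = x].
Proof.
case: hD => _ _ [_ [f [fc fK Kf]]]; exists f; split=> // d g.
exact: (fK (d, g)).
Qed.

(** [domain_rep] and [domain_coord] are the components of an inverse homeomorphism picked by choice:
    the point of [D] in the orbit of [x], and the group element carrying it to [x]. *)
Definition domain_rep (x : X) : D := (sval (cid inverse_exists) x).1.

Definition domain_coord (x : X) : discrete_topology G :=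
  (sval (cid inverse_exists) x).2.

Lemma domain_rep_continuous : continuous domain_rep.
Proof.
have [fc _ _] := svalP (cid inverse_exists).
exact: (continuous_comp_fun fc (@continuous_fst _ _)).
Qed.

Lemma domain_coord_continuous : continuous domain_coord.
Proof.
have [fc _ _] := svalP (cid inverse_exists).
exact: (continuous_comp_fun fc (@continuous_snd _ _)).
Qed.

Lemma domain_repE (d : D) g : domain_rep (act g (set_val d)) = d.
Proof.
have [_ fE _] := svalP (cid inverse_exists).
by rewrite /domain_rep fE.
Qed.

Lemma domain_coordE (d : D) g : domain_coord (act g (set_val d)) = g.
Proof.
have [_ fE _] := svalP (cid inverse_exists).
by rewrite /domain_coord fE.
Qed.

Lemma domain_decomp x : act (domain_coord x) (set_val (domain_rep x)) = x.
Proof. by have [_ _ decomp] := svalP (cid inverse_exists); exact: decomp. Qed.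

End Coordinates.

Definition range_map (A : Type) (i : A -> X) (a : A) : range i :=
  SigSub (mem_set (imageT i a)).

Lemma range_map_homeomorphism (A : topologicalType) (i : A -> X) (r : X -> A) :
  continuous i -> continuous r -> cancel i r -> homeomorphism (range_map i).
Proof.
move=> ic rc iK; split; first exact: continuous_to_set_type.
exists (fun d => r (set_val d)); split.
- by apply: continuous_comp_fun rc; exact: continuous_set_val.
- by move=> a; exact: iK.
move=> [x xi]; apply: set_val_inj; change (i (r x) = x).
by have [a _ <-] := set_mem xi; rewrite iK.
Qed.

(** The pair [(r, k)] inverts the orbit map. The hypotheses concern a bare family [act], so that
    right actions are covered as well. *)
Lemma fundamental_domain_of_section (A : topologicalType) (i : A -> X)
    (r : X -> A) (k : X -> discrete_topology G) :
  compact [set: A] -> (forall g, continuous (act g)) ->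
  continuous i -> continuous r -> continuous k ->
  (forall a, act 1 (i a) = i a) -> (forall x, act (k x) (i (r x)) = x) ->
  (forall g a, r (act g (i a)) = a) -> (forall g a, k (act g (i a)) = g) ->
  compact_open_fundamental_domain act (range i).
Proof.
move=> cA actc ic rc kc act1 decomp rE kE; split.
- exact: continuous_compact_image.
(* The section is the fibre over 1 of a continuous map to a discrete space, hence open. *)
- rewrite (_ : range i = k @^-1` [set 1]).
    by apply: open_comp; [move=> x _; exact: kc|exact: discrete_open].
  apply/seteqP; split=> [_ [a _ <-] /=|x /= kx].
    by rewrite -{1}act1 kE.
  by exists (r x) => //; rewrite -act1 -{1}kx decomp.
split.
  apply: (@continuous_family _ _ _ _ act snd (fun d => set_val d.1)) => //.
    exact: continuous_snd.
  by apply: continuous_comp_fun (@continuous_set_val _ _); exact: continuous_fst.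
exists (fun x => (range_map i (r x), k x)); split.
- apply: continuous_pair kc; apply: continuous_to_set_type.
  exact: continuous_comp_fun rc ic.
- move=> [[x xi] g] /=; have [a _ ax] := set_mem xi; subst x.
  by congr pair; [apply: set_val_inj|]; rewrite /= ?rE ?kE.
- by move=> x; exact: decomp.
Qed.

End FundamentalDomain.

Local Notation domX W := (@tc_X _ _ W).
Local Notation domY W := (@tc_Y _ _ W).

(** * Coordinates on a coupling *)

Section CouplingCoordinates.
Variables (G H : groupType) (W : topological_coupling G H).
Implicit Types (w : tc_space W) (s : G) (t : H).

(** Every H-orbit meets [tc_X W] exactly once and every G-orbit meets [tc_Y W] exactly once, so
    [repX] and [repY] are the quotient maps onto Omega/H and G\Omega. *)
Definition repX w : domX W := domain_rep (tc_X_domain W) w.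
Definition repY w : domY W := domain_rep (tc_Y_domain W) w.
Definition coordH w : discrete_topology H := domain_coord (tc_X_domain W) w.
Definition coordG w : discrete_topology G := domain_coord (tc_Y_domain W) w.

Lemma repX_continuous : continuous repX.
Proof. exact: domain_rep_continuous. Qed.

Lemma repY_continuous : continuous repY.
Proof. exact: domain_rep_continuous. Qed.

Lemma coordH_continuous : continuous coordH.
Proof. exact: domain_coord_continuous. Qed.

Lemma coordG_continuous : continuous coordG.
Proof. exact: domain_coord_continuous. Qed.

Lemma decompX w : tc_ract (set_val (repX w)) (coordH w) = w.
Proof. exact: (domain_decomp (tc_X_domain W)). Qed.

Lemma decompY w : tc_lact (coordG w) (set_val (repY w)) = w.
Proof. exact: (domain_decomp (tc_Y_domain W)). Qed.

Lemma ract1 w : tc_ract w 1 = w.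
Proof. by case: (tc_ractP W). Qed.

Lemma ractM w t t' : tc_ract w (t * t') = tc_ract (tc_ract w t) t'.
Proof. by case: (tc_ractP W). Qed.

Lemma lact1 w : tc_lact 1 w = w.
Proof. by case: (tc_lactP W). Qed.

Lemma lactM s s' w : tc_lact (s * s') w = tc_lact s (tc_lact s' w).
Proof. by case: (tc_lactP W). Qed.

Lemma tc_lact_continuous s : continuous (@tc_lact _ _ W s).
Proof. by case: (tc_lact_homeo W s). Qed.

Lemma tc_ract_continuous t : continuous (fun w => tc_ract w t).
Proof. by case: (tc_ract_homeo W t). Qed.

Lemma repX_ract w t : repX (tc_ract w t) = repX w.
Proof.
by rewrite -{1}(decompX w) -ractM; exact: (domain_repE (tc_X_domain W)).
Qed.

Lemma repY_lact s w : repY (tc_lact s w) = repY w.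
Proof.
by rewrite -{1}(decompY w) -lactM; exact: (domain_repE (tc_Y_domain W)).
Qed.

Lemma repX_ractE (x : domX W) t : repX (tc_ract (set_val x) t) = x.
Proof. exact: (domain_repE (tc_X_domain W)). Qed.

Lemma repY_lactE s (y : domY W) : repY (tc_lact s (set_val y)) = y.
Proof. exact: (domain_repE (tc_Y_domain W)). Qed.

Lemma coordH_ractE (x : domX W) t :
  coordH (tc_ract (set_val x) t) = t.
Proof. exact: (domain_coordE (tc_X_domain W)). Qed.

Lemma repX_val (x : domX W) : repX (set_val x) = x.
Proof. by rewrite -(ract1 (set_val x)) repX_ractE. Qed.

Lemma repY_val (y : domY W) : repY (set_val y) = y.
Proof. by rewrite -(lact1 (set_val y)) repY_lactE. Qed.

Lemma val_repX_id w : domX W w -> set_val (repX w) = w.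
Proof.
by move=> Xw; have /(congr1 set_val) := repX_val (SigSub (mem_set Xw)).
Qed.

Lemma val_repY_id w : domY W w -> set_val (repY w) = w.
Proof.
by move=> Yw; have /(congr1 set_val) := repY_val (SigSub (mem_set Yw)).
Qed.

Lemma val_repX w : set_val (repX w) = tc_ract w (coordH w)^-1.
Proof. by rewrite -{2}(decompX w) -ractM mulgV ract1. Qed.

Lemma val_repY w : set_val (repY w) = tc_lact (coordG w)^-1 w.
Proof. by rewrite -{3}(decompY w) -lactM mulVg lact1. Qed.

(** The G-action commutes with that of H and so descends to Omega/H; this is why the induced maps on
    [tc_X W] form an action. *)
Lemma repX_lact_repX s w :
  repX (tc_lact s (set_val (repX w))) = repX (tc_lact s w).
Proof. by rewrite val_repX -tc_commute repX_ract. Qed.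

Lemma repY_ract_repY w t :
  repY (tc_ract (set_val (repY w)) t) = repY (tc_ract w t).
Proof. by rewrite val_repY tc_commute repY_lact. Qed.

End CouplingCoordinates.
Arguments repX {G H W} w.
Arguments repY {G H W} w.
Arguments coordH {G H W} w.
Arguments coordG {G H W} w.

(** * Realizations of couples by couplings *)

(** The inverse in [re_actY] turns the right H-action on Omega into a left action on G\Omega. *)
Record realization (G H : groupType) (C : continuous_orbit_couple G H)
    (W : topological_coupling G H) := Realization {
  re_X : oc_X C -> domX W;
  re_Y : oc_Y C -> domY W;
  re_X_homeo : homeomorphism re_X;
  re_Y_homeo : homeomorphism re_Y;
  re_actX : forall s x,
    re_X (oc_actX s x) = repX (tc_lact s (set_val (re_X x)));
  re_actY : forall t y,
    re_Y (oc_actY t y) = repY (tc_ract (set_val (re_Y y)) t^-1);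
  re_p : forall x, re_Y (oc_p x) = repY (set_val (re_X x));
  re_q : forall y, re_X (oc_q y) = repX (set_val (re_Y y))
}.

(** * The orbit couple of a coupling *)

Section OrbitCoupleOfCoupling.
Variables (G H : groupType) (W : topological_coupling G H).

Let actX (s : G) (x : domX W) : domX W := repX (tc_lact s (set_val x)).
Let actY (t : H) (y : domY W) : domY W := repY (tc_ract (set_val y) t^-1).
Let p (x : domX W) : domY W := repY (set_val x).
Let q (y : domY W) : domX W := repX (set_val y).

Let actXP : left_action actX.
Proof.
split=> [x|s t x]; rewrite /actX; first by rewrite lact1 repX_val.
by rewrite repX_lact_repX lactM.
Qed.

Let actYP : left_action actY.
Proof.
split=> [y|s t y]; rewrite /actY; first by rewrite invg1 ract1 repY_val.
by rewrite repY_ract_repY invgM ractM.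
Qed.

Let actX_continuous s : continuous (actX s).
Proof.
apply: continuous_comp_fun (@repX_continuous _ _ W).
apply: continuous_comp_fun (@tc_lact_continuous _ _ W s).
exact: continuous_set_val.
Qed.

Let actY_continuous t : continuous (actY t).
Proof.
apply: continuous_comp_fun (@repY_continuous _ _ W).
apply: continuous_comp_fun (@tc_ract_continuous _ _ W t^-1).
exact: continuous_set_val.
Qed.

Let p_continuous : continuous p.
Proof.
apply: continuous_comp_fun (@repY_continuous _ _ W).
exact: continuous_set_val.
Qed.

Let q_continuous : continuous q.
Proof.
apply: continuous_comp_fun (@repX_continuous _ _ W).
exact: continuous_set_val.
Qed.

(** In Omega, [s.x] is [actX s x] moved by [a(s, x)], and [y] moved by [t^-1] is [actY t y] moved by
    [b(t, y)^-1]. Applying the quotient map of the other side gives the equations. Likewise [g] and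
    [h] come from the coordinates of a point of one domain with respect to the other. *)
Let cocycles :
  exists (a : discrete_topology G * domX W -> discrete_topology H)
         (b : discrete_topology H * domY W -> discrete_topology G)
         (g : domX W -> discrete_topology G)
         (h : domY W -> discrete_topology H),
    [/\ continuous a, continuous b, continuous g & continuous h] /\
    [/\ forall s x, p (actX s x) = actY (a (s, x)) (p x),
        forall t y, q (actY t y) = actX (b (t, y)) (q y),
        forall x, q (p x) = actX (g x) x & forall y, p (q y) = actY (h y) y].
Proof.
exists (fun sx => coordH (tc_lact sx.1 (set_val sx.2))).
exists (fun ty => (coordG (tc_ract (set_val ty.2) ty.1^-1))^-1).
exists (fun x => (coordG (set_val x))^-1).
exists (fun y => coordH (set_val y)).
have coordGVc : continuous
    (fun w : tc_space W => (coordG w)^-1 : discrete_topology G).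
  apply: (@continuous_discrete_op (tc_space W) G G (fun s => s^-1)).
  exact: coordG_continuous.
split; split.
- apply: continuous_comp_fun (@coordH_continuous _ _ W).
  apply: (continuous_family (F := fun s x => tc_lact s (set_val x))).
  + move=> s; apply: continuous_comp_fun (@tc_lact_continuous _ _ W s).
    exact: continuous_set_val.
  + exact: continuous_fst.
  + exact: continuous_snd.
- apply: (continuous_comp_fun _ coordGVc).
  apply: (continuous_family (F := fun t y => tc_ract (set_val y) t^-1)).
  + move=> t; apply: continuous_comp_fun (@tc_ract_continuous _ _ W t^-1).
    exact: continuous_set_val.
  + exact: continuous_fst.
  + exact: continuous_snd.
- by apply: (continuous_comp_fun _ coordGVc); exact: continuous_set_val.
- apply: continuous_comp_fun (@coordH_continuous _ _ W).
  exact: continuous_set_val.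
- by move=> s x; rewrite /p /actX /actY repY_ract_repY val_repX tc_commute
    repY_lact.
- by move=> t y; rewrite /q /actX /actY repX_lact_repX val_repY -tc_commute
    repX_ract.
- by move=> x; rewrite /p /q /actX val_repY.
- by move=> y; rewrite /p /q /actY val_repX.
Qed.

Definition couple_of_coupling : continuous_orbit_couple G H :=
  ContinuousOrbitCouple
    (hausdorff_set_type (@tc_hausdorff _ _ W))
    (hausdorff_set_type (@tc_hausdorff _ _ W))
    (compact_set_type (fundamental_domain_compact (tc_X_domain W)))
    (compact_set_type (fundamental_domain_compact (tc_Y_domain W)))
    actXP actYP
    (left_action_by_homeomorphisms actXP actX_continuous)
    (left_action_by_homeomorphisms actYP actY_continuous)
    p_continuous q_continuous cocycles.

Definition couple_of_coupling_realization : realization couple_of_coupling W.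
Proof.
apply: (@Realization _ _ couple_of_coupling W (fun x => x) (fun y => y)) => //;
  exact: homeomorphism_id.
Defined.

(** If [s] fixes an open part of [tc_X W] pointwise, then in Omega it moves each [w] there by its
    H-coordinate, which is locally constant. So one nontrivial pair fixes a nonempty open subset of
    Omega. The argument for [tc_Y W] is symmetric. *)
Lemma couple_of_coupling_topologically_free :
  tc_topologically_free W -> oc_topologically_free couple_of_coupling.
Proof.
have [_ openX _] := tc_X_domain W; have [_ openY _] := tc_Y_domain W.
have repXc := @repX_continuous _ _ W; have repYc := @repY_continuous _ _ W.
have valXc := @continuous_set_val _ (domX W).
have valYc := @continuous_set_val _ (domY W).
move=> Wfree; split.
- move=> s s1 O [x Ox] oO; apply: contrapT => fixO.
  (* Going through [repX] defines [k] on all of Omega; on [tc_X W] it is the H-coordinate of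
     [tc_lact s w]. *)
  pose k (w : tc_space W) := coordH (tc_lact s (set_val (repX w))).
  have kc : continuous k.
    apply: continuous_comp_fun (@coordH_continuous _ _ W).
    apply: continuous_comp_fun (@tc_lact_continuous _ _ W s).
    by apply: continuous_comp_fun valXc; exact: repX_continuous.
  pose O' := @tc_X _ _ W `&` (repX @^-1` O `&` k @^-1` [set k (set_val x)]).
  have oO' : open O'.
    apply: openI => //; apply: openI.
      by apply: open_comp => // w _; exact: repXc.
    apply: open_comp => [w _|]; [exact: kc|exact: discrete_open].
  have st1 : (s, k (set_val x) : H) <> (1, 1) by case.
  have [|w [[Xw [Ow tw]]]] := Wfree _ st1 O' _ oO'.
    by exists (set_val x); split; [exact: set_valP|split; rewrite /= ?repX_val].
  apply; rewrite /tc_act /= -tw.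
  have fixw : actX s (repX w) = repX w.
    by apply: contrapT => nfix; apply: fixO; exists (repX w).
  have kw : k w = coordH (tc_lact s w) by rewrite /k val_repX_id.
  rewrite -tc_commute kw -val_repX -repX_lact_repX.
  by rewrite -/(actX _ _) fixw val_repX_id.
- move=> t t1 O [y Oy] oO; apply: contrapT => fixO.
  pose k (w : tc_space W) := coordG (tc_ract (set_val (repY w)) t^-1).
  have kc : continuous k.
    apply: continuous_comp_fun (@coordG_continuous _ _ W).
    apply: continuous_comp_fun (@tc_ract_continuous _ _ W t^-1).
    by apply: continuous_comp_fun valYc; exact: repY_continuous.
  pose O' := @tc_Y _ _ W `&` (repY @^-1` O `&` k @^-1` [set k (set_val y)]).
  have oO' : open O'.
    apply: openI => //; apply: openI.
      by apply: open_comp => // w _; exact: repYc.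
    apply: open_comp => [w _|]; [exact: kc|exact: discrete_open].
  (* On [O'] the point [w] moved by [t^-1] is [tc_lact (k w) w], hence the inverse in the first
     component. *)
  have st1 : ((k (set_val y) : G)^-1, t) <> (1, 1) by case.
  have [|w [[Yw [Ow tw]]]] := Wfree _ st1 O' _ oO'.
    by exists (set_val y); split; [exact: set_valP|split; rewrite /= ?repY_val].
  apply; rewrite /tc_act /= -tw.
  have fixw : actY t (repY w) = repY w.
    by apply: contrapT => nfix; apply: fixO; exists (repY w).
  have kw : k w = coordG (tc_ract w t^-1) by rewrite /k val_repY_id.
  rewrite kw -val_repY -repY_ract_repY.
  by rewrite -/(actY _ _) fixw val_repY_id.
Qed.

End OrbitCoupleOfCoupling.

(** * Isomorphic couplings realize isomorphic couples *)

Section IsomorphismOfCouples.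
Variables (G H : groupType) (W1 W2 : topological_coupling G H).
Variables (C1 C2 : continuous_orbit_couple G H).
Variables (R1 : realization C1 W1) (R2 : realization C2 W2).

(** An equivariant [f] is compatible with the quotient maps and restricts to the fundamental
    domains; the restrictions are transported along the identifications in [R1] and [R2]. *)
Lemma couple_isomorphic_of_coupling_isomorphic :
  tc_isomorphic W1 W2 -> oc_isomorphic C1 C2.
Proof.
move=> [f [fhomeo fE fX fY]].
have fl s w : f (tc_lact s w) = tc_lact s (f w).
  by have := fE (s, 1) w; rewrite /tc_act /= invg1 !ract1.
have fr t w : f (tc_ract w t) = tc_ract (f w) t.
  by have := fE (1, t^-1) w; rewrite /tc_act /= invgK !lact1.
have frepX w : repX (f (set_val (repX w))) = repX (f w).
  by rewrite val_repX fr repX_ract.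
have frepY w : repY (f (set_val (repY w))) = repY (f w).
  by rewrite val_repY fl repY_lact.
(* Since [f] maps domain to domain, [repX] here only retypes the point. *)
have fvalX (x : domX W1) : set_val (repX (f (set_val x))) = f (set_val x).
  by apply: val_repX_id; rewrite -fX; exists (set_val x) => //; exact: set_valP.
have fvalY (y : domY W1) : set_val (repY (f (set_val y))) = f (set_val y).
  by apply: val_repY_id; rewrite -fY; exists (set_val y) => //; exact: set_valP.
have [fc [f' [f'c fK Kf]]] := fhomeo.
have f'valX (x : domX W2) : set_val (repX (f' (set_val x))) = f' (set_val x).
  have [w Xw wE] : (f @` @tc_X _ _ W1) (set_val x).
    by rewrite fX; exact: set_valP.
  by apply: val_repX_id; rewrite -wE fK.
have f'valY (y : domY W2) : set_val (repY (f' (set_val y))) = f' (set_val y).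
  have [w Yw wE] : (f @` @tc_Y _ _ W1) (set_val y).
    by rewrite fY; exact: set_valP.
  by apply: val_repY_id; rewrite -wE fK.
have fXhomeo : homeomorphism (fun x : domX W1 => repX (f (set_val x))).
  split.
    apply: continuous_comp_fun (@repX_continuous _ _ W2).
    by apply: continuous_comp_fun fc; exact: continuous_set_val.
  exists (fun x : domX W2 => repX (f' (set_val x))); split.
  - apply: continuous_comp_fun (@repX_continuous _ _ W1).
    by apply: continuous_comp_fun f'c; exact: continuous_set_val.
  - by move=> x; rewrite fvalX fK repX_val.
  - by move=> x; rewrite f'valX Kf repX_val.
have fYhomeo : homeomorphism (fun y : domY W1 => repY (f (set_val y))).
  split.
    apply: continuous_comp_fun (@repY_continuous _ _ W2).
    by apply: continuous_comp_fun fc; exact: continuous_set_val.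
  exists (fun y : domY W2 => repY (f' (set_val y))); split.
  - apply: continuous_comp_fun (@repY_continuous _ _ W1).
    by apply: continuous_comp_fun f'c; exact: continuous_set_val.
  - by move=> y; rewrite fvalY fK repY_val.
  - by move=> y; rewrite f'valY Kf repY_val.
have [i2c [i2 [i2'c i2K Ki2]]] := re_X_homeo R2.
have [j2c [j2 [j2'c j2K Kj2]]] := re_Y_homeo R2.
have i2homeo : homeomorphism i2 by split=> //; exists (re_X R2).
have j2homeo : homeomorphism j2 by split=> //; exists (re_Y R2).
exists (fun x => i2 (repX (f (set_val (re_X R1 x))))).
exists (fun y => j2 (repY (f (set_val (re_Y R1 y))))).
split.
- split.
    exact: (homeomorphism_comp (re_X_homeo R1)
      (homeomorphism_comp fXhomeo i2homeo)).
  exact: (homeomorphism_comp (re_Y_homeo R1)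
    (homeomorphism_comp fYhomeo j2homeo)).
- move=> s x; apply: (can_inj i2K); rewrite Ki2 !re_actX Ki2 frepX fl.
  by rewrite repX_lact_repX.
- move=> t y; apply: (can_inj j2K); rewrite Kj2 !re_actY Kj2 frepY fr.
  by rewrite repY_ract_repY.
- apply/funext => x /=; apply: (can_inj j2K); rewrite Kj2 !re_p Ki2 frepY.
  by rewrite fvalX.
- apply/funext => y /=; apply: (can_inj i2K); rewrite Ki2 !re_q Kj2 frepX.
  by rewrite fvalY.
Qed.

End IsomorphismOfCouples.

(** * Uniqueness of cocycles *)

(* If f and f' differ at z, then f'(z)^-1 f(z) fixes the points of the
   neighbourhood pi(U) of pi(z), where U is a neighbourhood of z on which f and
   f' are constant. *)
Lemma cocycle_unique (K : groupType) (Z Y : topologicalType)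
    (act : K -> Y -> Y) (pi : Z -> Y) (f f' : Z -> discrete_topology K) :
  left_action act -> topologically_free_action 1 act ->
  (forall z U, nbhs z U -> nbhs (pi z) (pi @` U)) ->
  continuous f -> continuous f' ->
  (forall z, act (f z) (pi z) = act (f' z) (pi z)) -> forall z, f z = f' z.
Proof.
move=> actP actfree piopen /continuous_to_discreteP fc.
move=> /continuous_to_discreteP f'c fE z; apply: contrapT => ff'.
pose s : K := (f' z : K)^-1 * f z.
have s1 : s <> 1.
  move=> s1; apply: ff'; have := congr1 (fun u => (f' z : K) * u) s1.
  by rewrite /s mulVKg mulg1.
have nU := piopen _ _ (filterI (fc z) (f'c z)).
set V := _ @` _ in nU.
have [||y [/interior_subset [z' [/= fz' f'z'] <-]]] := actfree s s1 V°.
- by exists (pi z); exact: nU.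
- exact: open_interior.
apply.
by rewrite /s actP.2 -fz' fE f'z' left_actK.
Qed.

(** * Openness of the maps of a couple *)

Section OrbitCouples.
Variables (G H : groupType) (C : continuous_orbit_couple G H).
Implicit Types (x : oc_X C) (y : oc_Y C) (s : G) (t : H).

Lemma oc_actX_continuous s : continuous (@oc_actX _ _ C s).
Proof. by case: (oc_actX_homeo C s). Qed.

Lemma oc_actY_continuous t : continuous (@oc_actY _ _ C t).
Proof. by case: (oc_actY_homeo C t). Qed.

Lemma oc_actXM s s' x : oc_actX (s * s') x = oc_actX s (oc_actX s' x).
Proof. by case: (oc_actXP C) => _; apply. Qed.

Lemma oc_actYM t t' y : oc_actY (t * t') y = oc_actY t (oc_actY t' y).
Proof. by case: (oc_actYP C) => _; apply. Qed.

Lemma oc_actXK s : cancel (@oc_actX _ _ C s) (oc_actX s^-1).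
Proof. exact: left_actK (oc_actXP C). Qed.

Lemma oc_actYK t : cancel (@oc_actY _ _ C t) (oc_actY t^-1).
Proof. exact: left_actK (oc_actYP C). Qed.

(** There is a continuous map [u] with [u(p(x)) = x] and [p(u(y)) = y] for [y] near [p(x)]. Every
    such [y] with [u(y)] in [U] therefore lies in the image of [U]. *)
Lemma oc_p_nbhs x (U : set (oc_X C)) :
  nbhs x U -> nbhs (oc_p x) (@oc_p _ _ C @` U).
Proof.
move=> nU; have [a [b [g [h [[ac _ gc hc] [aE _ gE hE]]]]]] := oc_cocycles C.
(* Compare [p(q(y)) = h(y).y] with [p(g(x).u) = a(g(x), u).p(u)]: where [h] and [a(g(x), _)] keep
   their values at [p(x)] and [x], the relation [g(x).u = q(y)] forces [y = k.p(u)]. In particular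
   [k] fixes [p(x)]. *)
pose k : H := (h (oc_p x) : H)^-1 * a (g x, x).
have kE y u : oc_actX (g x) u = oc_q y -> h y = h (oc_p x) ->
    a (g x, u) = a (g x, x) -> y = oc_actY k (oc_p u).
  move=> uE hyE aE'; rewrite /k oc_actYM -aE' -aE uE hE hyE.
  by rewrite oc_actYK.
have kfix : oc_actY k (oc_p x) = oc_p x by apply: esym; apply: kE.
have axc : continuous (fun u => a (g x, u) : discrete_topology H).
  apply: continuous_comp_fun ac; apply: continuous_pair.
    by move=> u; exact: cvg_cst.
  exact: continuous_idfun.
(* This solves [g(x).u = q(k.y)], so [kE] at the point [k.y] gives [k.y = k.p(u(y))], and [k]
   cancels. *)
pose u y := oc_actX (g x)^-1 (oc_q (oc_actY k y)).
have kc := @oc_actY_continuous k.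
have uc : continuous u.
  apply: continuous_comp_fun (@oc_actX_continuous (g x)^-1).
  exact: (continuous_comp_fun kc (@oc_q_continuous _ _ C)).
have ux : u (oc_p x) = x by rewrite /u kfix gE oc_actXK.
have hkc : continuous (fun y => h (oc_actY k y)) by exact: continuous_comp_fun.
have nh := (continuous_to_discreteP _).1 hkc (oc_p x).
have na := (continuous_to_discreteP _).1 axc x.
have nV : nbhs (oc_p x) (u @^-1`
    (U `&` [set u' | a (g x, u') = a (g x, x)])).
  by apply: uc; rewrite ux; exact: filterI.
apply: filterS (filterI nh nV) => y [/= hy [Uu au]].
exists (u y) => //; apply: (can_inj (@oc_actYK k)).
apply: esym; apply: kE => //; last by rewrite hy kfix.
by rewrite /u -oc_actXM mulgV; case: (oc_actXP C).
Qed.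

(** Exchanging G and H transfers openness from [p] to [q]; the definition is transparent so that the
    transfer holds by conversion. *)
Definition couple_swap : continuous_orbit_couple H G.
Proof.
apply: (ContinuousOrbitCouple (@oc_hausdorffY _ _ C) (@oc_hausdorffX _ _ C)
  (@oc_compactY _ _ C) (@oc_compactX _ _ C) (oc_actYP C) (oc_actXP C)
  (oc_actY_homeo C) (oc_actX_homeo C) (@oc_q_continuous _ _ C)
  (@oc_p_continuous _ _ C)).
have [a [b [g [h [[ac bc gc hc] [aE bE gE hE]]]]]] := oc_cocycles C.
by exists b, a, h, g.
Defined.

End OrbitCouples.

Lemma oc_q_nbhs (G H : groupType) (C : continuous_orbit_couple G H)
    (y : oc_Y C) (U : set (oc_Y C)) :
  nbhs y U -> nbhs (oc_q y) (@oc_q _ _ C @` U).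
Proof. exact: (@oc_p_nbhs _ _ (couple_swap C)). Qed.

(** * The cocycle and the shift read off a realization *)

Section CoordinatesOfRealization.
Variables (G H : groupType) (C : continuous_orbit_couple G H).
Variables (W : topological_coupling G H) (R : realization C W).

(** [re_cocycle] and [re_shift] are choices of the functions [a] and [h] of the couple, as the
    coupling provides them. *)
Definition re_cocycle (s : G) (x : oc_X C) : discrete_topology H :=
  coordH (tc_lact s (set_val (re_X R x))).

Definition re_shift (y : oc_Y C) : discrete_topology H :=
  coordH (set_val (re_Y R y)).

Let re_Y_inj : injective (re_Y R).
Proof. by have [_ [j [_ jK _]]] := re_Y_homeo R; exact: can_inj jK. Qed.

Lemma re_cocycle_continuous s : continuous (re_cocycle s).
Proof.
apply: continuous_comp_fun (@coordH_continuous _ _ W).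
apply: continuous_comp_fun (@tc_lact_continuous _ _ W s).
apply: continuous_comp_fun (@continuous_set_val _ _).
by case: (re_X_homeo R).
Qed.

Lemma re_shift_continuous : continuous re_shift.
Proof.
apply: continuous_comp_fun (@coordH_continuous _ _ W).
apply: continuous_comp_fun (@continuous_set_val _ _).
by case: (re_Y_homeo R).
Qed.

(** This formula and [val_re_Y] recover the G-action and the domain [tc_Y W] from [tc_X W], the
    right H-action, the cocycle and the shift. *)
Lemma lact_re_X s x : tc_lact s (set_val (re_X R x)) =
  tc_ract (set_val (re_X R (oc_actX s x))) (re_cocycle s x).
Proof. by rewrite re_actX decompX. Qed.

Lemma val_re_Y y :
  set_val (re_Y R y) = tc_ract (set_val (re_X R (oc_q y))) (re_shift y).
Proof. by rewrite re_q decompX. Qed.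

Lemma re_cocycleE s x :
  oc_p (oc_actX s x) = oc_actY (re_cocycle s x) (oc_p x).
Proof.
apply: re_Y_inj; rewrite re_actY !re_p re_actX repY_ract_repY val_repX.
by rewrite tc_commute repY_lact.
Qed.

Lemma re_shiftE y : oc_p (oc_q y) = oc_actY (re_shift y) y.
Proof. by apply: re_Y_inj; rewrite re_actY re_p re_q val_repX. Qed.

End CoordinatesOfRealization.

(** * Equivariant extension from a fundamental domain *)

Section EquivariantExtension.
Variables (G H : groupType) (W1 W2 : topological_coupling G H).

(** The H-equivariant map that agrees with [j] on [tc_X W1]. *)
Definition extension (j : domX W1 -> domX W2) (w : tc_space W1) : tc_space W2 :=
  tc_ract (set_val (j (repX w))) (coordH w).

Lemma extensionE j x t :
  extension j (tc_ract (set_val x) t) = tc_ract (set_val (j x)) t.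
Proof. by rewrite /extension repX_ractE coordH_ractE. Qed.

Lemma extension_continuous j : continuous j -> continuous (extension j).
Proof.
move=> jc; apply: (continuous_family
  (F := fun t w => tc_ract (set_val (j (repX w))) t) (u := fun w => w)) => //.
- move=> t; apply: continuous_comp_fun (@tc_ract_continuous _ _ W2 t).
  apply: continuous_comp_fun (@continuous_set_val _ _).
  exact: (continuous_comp_fun (@repX_continuous _ _ W1)).
- exact: coordH_continuous.
- exact: continuous_idfun.
Qed.

End EquivariantExtension.

Lemma extension_homeomorphism (G H : groupType)
    (W1 W2 : topological_coupling G H) (j : domX W1 -> domX W2) :
  homeomorphism j -> homeomorphism (extension j).
Proof.
move=> [jc [j' [j'c jK j'K]]]; split; first exact: extension_continuous.
exists (extension j'); split; first exact: extension_continuous.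
- by move=> w; rewrite extensionE jK decompX.
- by move=> w; rewrite extensionE j'K decompX.
Qed.

(** * Isomorphic couples have isomorphic realizations *)

Section IsomorphismOfCouplings.
Variables (G H : groupType) (W1 W2 : topological_coupling G H).
Variables (C1 C2 : continuous_orbit_couple G H).
Variables (R1 : realization C1 W1) (R2 : realization C2 W2).

(** Uniqueness of cocycles matches the cocycles and the shifts of the two realizations. Matching
    cocycles make the H-equivariant extension of [theta] G-equivariant, and matching shifts make it
    carry [tc_Y W1] onto [tc_Y W2]. *)
Lemma coupling_isomorphic_of_couple_isomorphic :
  oc_topologically_free C1 -> oc_isomorphic C1 C2 -> tc_isomorphic W1 W2.
Proof.
move=> [_ freeY] [theta [eta [[thetah etah] thetaE etaE etap thetaq]]].
have etapE x : eta (oc_p x) = oc_p (theta x) := congr1 (fun f => f x) etap.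
have thetaqE y : theta (oc_q y) = oc_q (eta y) := congr1 (fun f => f y) thetaq.
have [thetac [theta' [_ thetaK theta'K]]] := thetah.
have [etac [eta' [_ etaK eta'K]]] := etah.
(* Both elements move [p(z)] to [p(s.z)], as is checked after applying the injective [eta]. *)
have cocE s x : re_cocycle R1 s x = re_cocycle R2 s (theta x).
  apply: (cocycle_unique (oc_actYP C1) freeY (@oc_p_nbhs _ _ C1)
    (@re_cocycle_continuous _ _ _ _ R1 s)
    (continuous_comp_fun thetac (@re_cocycle_continuous _ _ _ _ R2 s))).
  move=> z; apply: (can_inj etaK).
  by rewrite -re_cocycleE !etaE !etapE -re_cocycleE thetaE.
(* Both elements move [y] to [p(q(y))]; the open map is now the identity. *)
have shiftE y : re_shift R1 y = re_shift R2 (eta y).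
  apply: (cocycle_unique (pi := id) (oc_actYP C1) freeY _
    (@re_shift_continuous _ _ _ _ R1)
    (continuous_comp_fun etac (@re_shift_continuous _ _ _ _ R2))).
  - by move=> z U; rewrite image_id.
  move=> z; apply: (can_inj etaK).
  by rewrite -re_shiftE !etaE etapE thetaqE -re_shiftE.
have [_ [i1 [i1c i1K Ki1]]] := re_X_homeo R1.
have [_ [j1 [_ _ Kj1]]] := re_Y_homeo R1.
have [_ [i2 [_ _ Ki2]]] := re_X_homeo R2.
have [_ [j2 [_ _ Kj2]]] := re_Y_homeo R2.
have i1h : homeomorphism i1.
  by split=> //; exists (re_X R1); split=> //; case: (re_X_homeo R1).
pose f := extension (fun d => re_X R2 (theta (i1 d))).
have fE x t : f (tc_ract (set_val (re_X R1 x)) t) =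
    tc_ract (set_val (re_X R2 (theta x))) t by rewrite /f extensionE i1K.
have fr t w : f (tc_ract w t) = tc_ract (f w) t.
  by rewrite -(decompX w) -(Ki1 (repX w)) -ractM !fE ractM.
have fX x : f (set_val (re_X R1 x)) = set_val (re_X R2 (theta x)).
  by have := fE x 1; rewrite !ract1.
have fl s w : f (tc_lact s w) = tc_lact s (f w).
  rewrite -(decompX w) -(Ki1 (repX w)) fE -!tc_commute fr; congr tc_ract.
  by rewrite !lact_re_X fE thetaE cocE.
have fY y : f (set_val (re_Y R1 y)) = set_val (re_Y R2 (eta y)).
  by rewrite !val_re_Y fE thetaqE shiftE.
exists f; split.
- apply: extension_homeomorphism.
  exact: (homeomorphism_comp i1h (homeomorphism_comp thetah (re_X_homeo R2))).
- by move=> st w; rewrite /tc_act fl fr.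
- apply/seteqP; split=> [_ [w Xw <-]|w Xw].
    rewrite -(val_repX_id Xw) -(Ki1 (repX w)) fX; exact: set_valP.
  exists (set_val (re_X R1 (theta' (i2 (repX w))))); first exact: set_valP.
  by rewrite fX theta'K Ki2 val_repX_id.
- apply/seteqP; split=> [_ [w Yw <-]|w Yw].
    rewrite -(val_repY_id Yw) -(Kj1 (repY w)) fY; exact: set_valP.
  exists (set_val (re_Y R1 (eta' (j2 (repY w))))); first exact: set_valP.
  by rewrite fY eta'K Kj2 val_repY_id.
Qed.

End IsomorphismOfCouplings.

(** * The coupling of a couple *)

Section CouplingOfOrbitCouple.
Variables (G H : groupType) (C : continuous_orbit_couple G H).
Hypothesis Cfree : oc_topologically_free C.
Variables (a : discrete_topology G * oc_X C -> discrete_topology H)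
  (b : discrete_topology H * oc_Y C -> discrete_topology G)
  (g : oc_X C -> discrete_topology G) (h : oc_Y C -> discrete_topology H).
Hypotheses (ac : continuous a) (bc : continuous b) (gc : continuous g)
  (hc : continuous h).
Hypothesis aE : forall s x, oc_p (oc_actX s x) = oc_actY (a (s, x)) (oc_p x).
Hypothesis bE : forall t y, oc_q (oc_actY t y) = oc_actX (b (t, y)) (oc_q y).
Hypothesis gE : forall x, oc_q (oc_p x) = oc_actX (g x) x.
Hypothesis hE : forall y, oc_p (oc_q y) = oc_actY (h y) y.

Let Omega : topologicalType := (oc_X C * discrete_topology H)%type.
Let lact (s : G) (w : Omega) : Omega :=
  (oc_actX s w.1, (a (s, w.1) : H) * w.2).
Let ract (w : Omega) (t : H) : Omega := (w.1, (w.2 : H) * t).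

Let sectX (x : oc_X C) : Omega := (x, 1 : H).
Let sectY (y : oc_Y C) : Omega := (oc_q y, h y).
(** The point [(x, t)] is [(x, 1)] moved by [t], so its class in G\Omega, identified with Y, has to
    be [t^-1.p(x)]. *)
Let projY (w : Omega) : oc_Y C := oc_actY (w.2 : H)^-1 (oc_p w.1).
(** Chosen to solve [coordG(w).q(projY(w)) = x] for [w = (x, t)], given that
    [q(t^-1.p(x)) = b(t^-1, p(x)).g(x).x]. *)
Let coordG (w : Omega) : discrete_topology G :=
  ((b ((w.2 : H)^-1, oc_p w.1) : G) * g w.1)^-1.

Let a_continuous s : continuous (fun x => a (s, x) : discrete_topology H).
Proof.
apply: continuous_comp_fun ac; apply: continuous_pair.
  by move=> x; exact: cvg_cst.
exact: continuous_idfun.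
Qed.

(** Both sides are continuous in [x] and move [p(x)] to [p(s.s'.x)], so uniqueness of cocycles
    applies. *)
Let aM s s' x : a (s * s', x) = (a (s, oc_actX s' x) : H) * a (s', x).
Proof.
apply: (cocycle_unique (oc_actYP C) Cfree.2 (@oc_p_nbhs _ _ C)
  (f := fun x => a (s * s', x)) (@a_continuous (s * s'))
  (f' := fun x => (a (s, oc_actX s' x) : H) * a (s', x))).
  apply: (continuous_discrete_op2 (op := @mul H)); last exact: a_continuous.
  exact: continuous_comp_fun (@oc_actX_continuous _ _ C s') (@a_continuous s).
by move=> z; rewrite -aE oc_actXM !aE oc_actYM.
Qed.

(** The cocycle identity makes [a(1, x)] idempotent. *)
Let a1 x : a (1, x) = 1 :> H.
Proof.
have := aM 1 1 x; rewrite mulg1 (oc_actXP C).1 => aa.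
by apply: (@mulgI H (a (1, x))); rewrite mulg1 -aa.
Qed.

Let lact_continuous s : continuous (lact s).
Proof.
apply: continuous_pair.
  apply: continuous_comp_fun (@oc_actX_continuous _ _ C s).
  exact: continuous_fst.
apply: (continuous_discrete_op2 (op := @mul H)); last exact: continuous_snd.
by apply: continuous_comp_fun (@a_continuous s); exact: continuous_fst.
Qed.

Let ract_continuous t : continuous (ract^~ t).
Proof.
apply: continuous_pair; first exact: continuous_fst.
apply: (continuous_discrete_op (op := fun u : H => u * t)).
exact: continuous_snd.
Qed.

Let lactP : left_action lact.
Proof.
split=> [[x t]|s s' [x t]]; rewrite /lact /=.
  by rewrite a1 mul1g (oc_actXP C).1.
by rewrite aM oc_actXM mulgA.
Qed.

Let ractP : right_action ract.
Proof. by split=> [[x t]|[x t] u v]; rewrite /ract /= ?mulg1 ?mulgA. Qed.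

Let commute_lact_ract s t w : ract (lact s w) t = lact s (ract w t).
Proof. by rewrite /ract /lact /= mulgA. Qed.

Let ract_homeo : by_homeomorphisms (fun t w => ract w t).
Proof.
move=> t; split; first exact: ract_continuous.
exists (ract^~ t^-1); split; first exact: ract_continuous.
- by move=> w; rewrite -ractP.2 mulgV ractP.1.
- by move=> w; rewrite -ractP.2 mulVg ractP.1.
Qed.

Let lact_homeo : by_homeomorphisms lact.
Proof. exact: left_action_by_homeomorphisms. Qed.

Let slice_continuous (t : discrete_topology H) :
  continuous (fun x => (x, t) : Omega).
Proof.
apply: continuous_pair; first exact: continuous_idfun.
by move=> x; exact: cvg_cst.
Qed.

Let sectX_continuous : continuous sectX.
Proof. exact: slice_continuous. Qed.

Let sectY_continuous : continuous sectY.
Proof. exact: continuous_pair (@oc_q_continuous _ _ C) hc. Qed.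

Let p_fst_continuous : continuous (fun w : Omega => oc_p w.1).
Proof.
exact: continuous_comp_fun (@continuous_fst _ _) (@oc_p_continuous _ _ C).
Qed.

Let snd_inv_continuous :
  continuous (fun w : Omega => (w.2 : H)^-1 : discrete_topology H).
Proof.
apply: (@continuous_discrete_op _ H H (fun t => t^-1)).
exact: continuous_snd.
Qed.

Let projY_continuous : continuous projY.
Proof.
apply: (continuous_family (F := @oc_actY _ _ C)) => //.
exact: oc_actY_continuous.
Qed.

Let coordG_continuous : continuous coordG.
Proof.
apply: (@continuous_discrete_op _ G G (fun s => s^-1)).
apply: (continuous_discrete_op2 (op := @mul G)).
  exact: continuous_comp_fun
    (continuous_pair snd_inv_continuous p_fst_continuous) bc.
exact: continuous_comp_fun (@continuous_fst _ _) gc.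
Qed.

Let coordG_projY w : oc_actX (coordG w) (oc_q (projY w)) = w.1.
Proof. by rewrite /projY bE gE -(oc_actXM (b _)) /coordG oc_actXK. Qed.

Let projY_lact s w : projY (lact s w) = projY w.
Proof. by rewrite /projY /= aE invgM oc_actYM oc_actYK. Qed.

Let projY_sectY y : projY (sectY y) = y.
Proof. by rewrite /projY /= hE oc_actYK. Qed.

Let decompY w : lact (coordG w) (sectY (projY w)) = w.
Proof.
case: w => x t; rewrite /lact /= (coordG_projY (x, t)); congr pair.
pose w x' : Omega := (x', t).
have wc : continuous w by exact: slice_continuous.
have rc : continuous (fun x' => projY (w x')) by exact: continuous_comp_fun.
(* With [t] fixed, [f] is the discrepancy in the H-coordinate. It fixes [p(z)]: [t^-1] moves [p(z)]
   to [projY (w z)], then [h] moves that to its image under [p] after [q], and [a] moves this back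
   to [p(z)] by [coordG_projY]. Uniqueness of cocycles gives [f = 1]. *)
pose f x' : discrete_topology H :=
  (a (coordG (w x'), oc_q (projY (w x'))) : H) * h (projY (w x')) * t^-1.
have fc : continuous f.
  apply: (@continuous_discrete_op _ H H (fun u => u * t^-1)).
  apply: (continuous_discrete_op2 (op := @mul H)).
    apply: continuous_comp_fun ac; apply: continuous_pair.
      exact: continuous_comp_fun coordG_continuous.
    exact: continuous_comp_fun rc (@oc_q_continuous _ _ C).
  exact: continuous_comp_fun rc hc.
have f1 : f x = 1 :> H.
  apply: (cocycle_unique (oc_actYP C) Cfree.2 (@oc_p_nbhs _ _ C) fc
    (f' := fun=> 1)) => [z|z]; first exact: cvg_cst.
  rewrite (oc_actYP C).1 /f 2!oc_actYM -[oc_actY t^-1 _]/(projY (w z)) -hE -aE.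
  by rewrite coordG_projY.
by apply: (@mulIg H t^-1); rewrite mulgV -f1.
Qed.

(** Uniqueness on the other side, along the open map [q]: both elements move [q(y)] to [s.q(y)]. *)
Let coordG_lact_sectY s y : coordG (lact s (sectY y)) = s.
Proof.
apply: (cocycle_unique (oc_actXP C) Cfree.1 (@oc_q_nbhs _ _ C)
  (f := fun y => coordG (lact s (sectY y))) (f' := fun=> s)) => [||z].
- apply: continuous_comp_fun coordG_continuous.
  exact: continuous_comp_fun sectY_continuous (@lact_continuous s).
- by move=> z; exact: cvg_cst.
have := coordG_projY (lact s (sectY z)).
by rewrite projY_lact projY_sectY.
Qed.

(** This equivariance yields freeness and properness of the G-action. *)
Let coordG_lact s w : coordG (lact s w) = (s : G) * coordG w.
Proof. by rewrite -{1}(decompY w) -lactP.2 coordG_lact_sectY. Qed.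

Let hausdorff_Omega : hausdorff_space Omega.
Proof.
by apply: hausdorff_prod (@oc_hausdorffX _ _ C) _; exact: discrete_hausdorff.
Qed.

Let lact_free : free_action lact.
Proof.
move=> s w /(congr1 coordG); rewrite coordG_lact => sw.
by apply: (@mulIg G (coordG w)); rewrite mul1g.
Qed.

Let ract_free : free_action (fun t w => ract w t).
Proof.
move=> t w /(congr1 snd) /= wt.
by apply: (@mulgI H w.2); rewrite mulg1.
Qed.

Let lact_proper : proper_action lact.
Proof.
apply: (proper_of_displacement (d := fun u v : G => u * v^-1) hausdorff_Omega
  lact_homeo coordG_continuous) => s w.
by rewrite coordG_lact mulgK.
Qed.

Let ract_proper : proper_action (fun t w => ract w t).
Proof.
apply: (proper_of_displacement (d := fun u v : H => v^-1 * u) hausdorff_Omega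
  ract_homeo (@continuous_snd _ _)) => t w.
by rewrite mulKg.
Qed.

Let X_domain :
  compact_open_fundamental_domain (fun t w => ract w t) (range sectX).
Proof.
apply: (fundamental_domain_of_section (r := fst) (k := snd)) => //.
- exact: oc_compactX.
- exact: continuous_fst.
- exact: continuous_snd.
- by move=> x; exact: ractP.1.
- by move=> [x t]; rewrite /ract /= mul1g.
- by move=> t x; rewrite /= mul1g.
Qed.

Let Y_domain : compact_open_fundamental_domain lact (range sectY).
Proof.
apply: (fundamental_domain_of_section (r := projY) (k := coordG)) => //.
- exact: oc_compactY.
- by move=> y; exact: lactP.1.
- by move=> s y; rewrite projY_lact projY_sectY.
Qed.

Let coupling : topological_coupling G H := TopologicalCoupling
  hausdorff_Omega
  (locally_compact_prod_discrete (@oc_hausdorffX _ _ C) (@oc_compactX _ _ C))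
  lactP ractP lact_homeo ract_homeo commute_lact_ract lact_free ract_free
  lact_proper ract_proper X_domain Y_domain.

Let coupling_topologically_free : tc_topologically_free coupling.
Proof.
move=> [s t] st1 O [[x u] Oxu] oO; apply: contrapT => fixO.
have fixE x' : O (x', u) ->
    tc_act (s, t) ((x', u) : tc_space coupling) = (x', u).
  by move=> Ox'; apply: contrapT => nfix; apply: fixO; exists (x', u).
(* A pair fixing an open set acts on its slice at height [u] with [s] fixing the first coordinates,
   so freeness on X gives [s = 1]; then [t = 1] because H acts freely on the right. *)
have s1 : s = 1.
  apply: contrapT => s1.
  have oO' : open ((fun x' : oc_X C => (x', u) : Omega) @^-1` O).
    by apply: open_comp => // x' _; exact: slice_continuous.
  have [x' [Ox']] := Cfree.1 s s1 _ (ex_intro _ x Oxu) oO'.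
  by apply; have /(congr1 fst) := fixE x' Ox'.
have := fixE x Oxu; rewrite s1 /tc_act /= lactP.1 => /ract_free t1.
by apply: st1; rewrite s1 -(invgK t) t1 invg1.
Qed.

(** [repX] comes from a chosen inverse; it is computed by writing [w] as a translate of a point of
    the section. *)
Let repX_eq (w : Omega) : repX (w : tc_space coupling) = range_map sectX w.1.
Proof.
have {1}-> : w = ract (set_val (range_map sectX w.1)) w.2.
  by case: w => x t; rewrite /ract /= mul1g.
exact: (@repX_ractE _ _ coupling).
Qed.

Let repY_eq (w : Omega) :
  repY (w : tc_space coupling) = range_map sectY (projY w).
Proof.
rewrite -{1}(decompY w).
exact: (@repY_lactE _ _ coupling _ (range_map sectY (projY w))).
Qed.

Lemma exists_coupling_realizing_cocycles :
  exists W : topological_coupling G H,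
    tc_topologically_free W /\ inhabited (realization C W).
Proof.
exists coupling; split=> //; constructor.
apply: (@Realization _ _ C coupling (range_map sectX) (range_map sectY)).
- exact: (range_map_homeomorphism (r := fst)) (@continuous_fst _ _) _.
- exact: (range_map_homeomorphism (r := projY)).
- by move=> s x; rewrite repX_eq.
(* Here [(h(y) t^-1)^-1.p(q(y)) = t.h(y)^-1.h(y).y = t.y]. *)
- move=> t y; rewrite repY_eq; congr range_map.
  by rewrite /projY /= invgM invgK oc_actYM hE oc_actYK.
- move=> x; rewrite repY_eq; congr range_map.
  by rewrite /projY /= invg1 (oc_actYP C).1.
- by move=> y; rewrite repX_eq.
Qed.

End CouplingOfOrbitCouple.

Lemma exists_coupling_of_couple (G H : groupType)
    (C : continuous_orbit_couple G H) : oc_topologically_free C ->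
  exists W : topological_coupling G H,
    tc_topologically_free W /\ inhabited (realization C W).
Proof.
move=> Cfree.
have [a [b [g [h [[ac bc gc hc] [aE bE gE hE]]]]]] := oc_cocycles C.
exact: (exists_coupling_realizing_cocycles Cfree ac bc gc hc aE bE gE hE).
Qed.

(** * Passage to isomorphism classes *)

Lemma isomorphism_class_bijection (S T : Type) (P : S -> Prop) (Q : T -> Prop)
    (isoS : S -> S -> Prop) (isoT : T -> T -> Prop) (R : S -> T -> Prop) :
  (forall c, P c -> exists w, Q w /\ R c w) ->
  (forall w, Q w -> exists c, P c /\ R c w) ->
  (forall c c' w w', P c -> R c w -> R c' w' -> isoS c c' -> isoT w w') ->
  (forall c c' w w', R c w -> R c' w' -> isoT w w' -> isoS c c') ->
  exists F : isomorphism_class P isoS -> isomorphism_class Q isoT, bijective F.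
Proof.
move=> exT exS isoST isoTS.
pose fwd (A : S -> Prop) w := Q w /\ exists c, A c /\ R c w.
pose bwd (B : T -> Prop) c := P c /\ exists w, B w /\ R c w.
(* The partners of the members of the class of [c0] form the class of any one partner [w0] of
   [c0]. *)
have fwd_class A : (exists c, P c /\ A = (fun d => P d /\ isoS c d)) ->
    exists w, Q w /\ fwd A = (fun d => Q d /\ isoT w d).
  move=> [c0 [Pc0 ->]]; have [w0 [Qw0 Rcw0]] := exT c0 Pc0.
  exists w0; split=> //; apply/predeqP => w; split=> -[Qw].
    by move=> [c [[Pc cc0] Rcw]]; split=> //; exact: isoST cc0.
  move=> ww0; split=> //; have [c [Pc Rcw]] := exS w Qw.
  by exists c; split=> //; split=> //; exact: isoTS ww0.
have bwd_class B : (exists w, Q w /\ B = (fun d => Q d /\ isoT w d)) ->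
    exists c, P c /\ bwd B = (fun d => P d /\ isoS c d).
  move=> [w0 [Qw0 ->]]; have [c0 [Pc0 Rcw0]] := exS w0 Qw0.
  exists c0; split=> //; apply/predeqP => c; split=> -[Pc].
    by move=> [w [[Qw ww0] Rcw]]; split=> //; exact: isoTS ww0.
  move=> cc0; split=> //; have [w [Qw Rcw]] := exT c Pc.
  by exists w; split=> //; split=> //; exact: isoST cc0.
exists (fun A => exist _ (fwd (sval A)) (fwd_class _ (svalP A))).
exists (fun B => exist _ (bwd (sval B)) (bwd_class _ (svalP B))).
- move=> [A classA]; apply: eq_sig_hprop => /= [?|].
    exact: Prop_irrelevance.
  (* A member [c] of the round trip shares a partner [w] with some [c'] in the class. For a partner
     [w0] of [c0], [isoST] relates [w0] to [w], and [isoTS] carries this back to [c0] and [c]. *)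
  have [c0 [Pc0 AE]] := classA; rewrite AE; apply/predeqP => c; split.
    move=> [Pc [w [[Qw [c' [[Pc' cc'] Rc'w]]] Rcw]]]; split=> //.
    have [w0 [_ Rc0w0]] := exT c0 Pc0.
    exact: isoTS Rc0w0 Rcw (isoST _ _ _ _ Pc0 Rc0w0 Rc'w cc').
  move=> [Pc cc0]; split=> //; have [w [Qw Rcw]] := exT c Pc.
  by exists w; split=> //; split=> //; exists c.
- move=> [B classB]; apply: eq_sig_hprop => /= [?|].
    exact: Prop_irrelevance.
  have [w0 [Qw0 BE]] := classB; rewrite BE; apply/predeqP => w; split.
    move=> [Qw [c [[Pc [w' [[Qw' ww'] Rcw']]] Rcw]]]; split=> //.
    have [c0 [Pc0 Rc0w0]] := exS w0 Qw0.
    exact: isoST Pc0 Rc0w0 Rcw (isoTS _ _ _ _ Rc0w0 Rcw' ww').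
  move=> [Qw ww0]; split=> //; have [c [Pc Rcw]] := exS w Qw.
  by exists c; split=> //; split=> //; exists w.
Qed.

Theorem theorem1p8 (G H : groupType)
    (countableG : countable [set: G]) (countableH : countable [set: H]) :
  exists F :
      isomorphism_class (@oc_topologically_free G H) (@oc_isomorphic G H) ->
      isomorphism_class (@tc_topologically_free G H) (@tc_isomorphic G H),
    bijective F.
Proof.
apply: (@isomorphism_class_bijection _ _ _ _ _ _
  (fun C W => inhabited (realization C W))).
- exact: exists_coupling_of_couple.
- move=> W Wfree; exists (couple_of_coupling W).
  by split; [exact: couple_of_coupling_topologically_free
            |constructor; exact: couple_of_coupling_realization].
- move=> C C' W W' Cfree [R] [R'].
  exact: (coupling_isomorphic_of_couple_isomorphic R R').
- move=> C C' W W' [R] [R'].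
  exact: (couple_isomorphic_of_coupling_isomorphic R R').
Qed.
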